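(* Let $\mathbb{K}\subseteq\mathbb{L}$ be valued fields with the same value group $G$, where the valuation $v$ of $\mathbb{L}$ extends that of $\mathbb{K}$. Assume that $G$ is divisible, that the residue field of $\mathbb{K}$ is infinite, that the valuation topology of $\mathbb{L}$ has a countable basis of neighbourhoods of $0$, and that $\mathbb{L}$ is complete for this topology. Let $S(X)=\sum b_nX^n\in\mathbb{L}[[X]]$ be a power series and let $a,b\in\mathbb{K}$ be such that $v(a)\le v(b)$. Assume that $S(X)$ is convergent at $a$ and that $S(a)\neq S(b)$. If $\alpha$ satisfies $\min\{v(S(a)),v(S(b))\}\le\alpha\le\max\{v(S(a)),v(S(b))\}$, then there is $c\in\mathbb{K}$ such that $v(S(c))=\alpha$ and $v(a)\le v(c)\le v(b)$.
   Context: A valued field is a field with a non-trivial (Krull) valuation, i.e. a surjective map $v$ onto $G\cup\{\infty\}$, with $G$ a totally ordered abelian group (of arbitrary rank) written additively, $v(x)=\infty$ iff $x=0$. The valuation topology has the sets $\{x: v(x)>\gamma\}$, $\gamma\in G$, as a basis of neighbourhoods of $0$. The residue field of $\mathbb{K}$ is $A/M$ with $A=\{x\in\mathbb{K}: v(x)\ge0\}$, $M=\{x\in\mathbb{K}: v(x)>0\}$. For $x\in\mathbb{L}$, $S(x)=\sum b_nx^n\in\mathbb{L}$ denotes the sum of the series when it converges in the valuation topology of $\mathbb{L}$; if $S$ converges at $x$ then it converges at every $y$ with $v(y)\ge v(x)$, so $S(b)$ is defined. *)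

(* Defs.v *)
From HB Require Import structures.
From mathcomp Require Import all_boot all_order all_algebra.
From mathcomp Require Import all_classical topology sequences.

Set Implicit Arguments.
Unset Strict Implicit.
Unset Printing Implicit Defensive.

Import Order.TTheory GRing.Theory Num.Theory.

Local Open Scope classical_set_scope.
Local Open Scope ring_scope.

(* Totality is a field of the mixin: inheriting from [Order.Total] is rejected
   by HB, as it would need a new structure below [Num.RealDomain]. *)
HB.mixin Record isOrderedAbGroup G & Num.POrderedZmodule G := {
  orderedab_total : total (<=%O : rel G) ;
  orderedab_leD2l : forall z x y : G, x <= y -> z + x <= z + y
}.

#[short(type="orderedAbGroupType")]
HB.structure Definition OrderedAbGroup :=
  {G of Num.POrderedZmodule G & isOrderedAbGroup G}.

Definition divisible (G : zmodType) :=
  forall (n : nat) (g : G), (0 < n)%N -> exists h : G, h *+ n = g.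

Inductive value (G : Type) : Type := Val of G | Infty.
Arguments Infty {G}.

Section ValueStructure.
Variable G : orderedAbGroupType.

Definition option_of_value (a : value G) : option G :=
  if a is Val g then Some g else None.
Definition value_of_option (o : option G) : value G :=
  if o is Some g then Val g else Infty.

Lemma option_of_valueK : cancel option_of_value value_of_option.
Proof. by case. Qed.

HB.instance Definition _ := Choice.copy (value G) (can_type option_of_valueK).

Definition le_value (a b : value G) : bool :=
  match a, b with
  | _, Infty => true
  | Infty, Val _ => false
  | Val g, Val h => g <= h
  end.

Lemma le_value_refl : reflexive le_value.
Proof. by case=> //= g. Qed.

Lemma le_value_anti : antisymmetric le_value.
Proof. by case=> [g|] [h|] //= /le_anti ->. Qed.

Lemma le_value_trans : transitive le_value.
Proof. by case=> [g|] [h|] [k|] //=; exact: le_trans. Qed.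

HB.instance Definition _ := Order.Le_isPOrder.Build ring_display (value G)
  le_value_refl le_value_anti le_value_trans.

Lemma le_value_total : total (<=%O : rel (value G)).
Proof. by case=> [g|] [h|] //; exact: orderedab_total. Qed.

HB.instance Definition _ :=
  Order.POrder_isTotal.Build ring_display (value G) le_value_total.

Definition add_value (a b : value G) : value G :=
  if a is Val g then if b is Val h then Val (g + h) else Infty else Infty.

Lemma le_ValE (g h : G) : (Val g <= Val h) = (g <= h).
Proof. by []. Qed.

Lemma lt_ValE (g h : G) : (Val g < Val h) = (g < h).
Proof. by rewrite !lt_def le_ValE. Qed.

Lemma lt_Infty (g : G) : Val g < Infty.
Proof. by rewrite ltNge. Qed.

End ValueStructure.

(* Surjectivity makes G the value group itself, not just a group containing it. *)
Record valuation (K : fieldType) (G : orderedAbGroupType) := Valuation {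
  valuation_fun :> K -> value G ;
  valuation_surj : forall a : value G, exists x, valuation_fun x = a ;
  valuation_Infty : forall x, valuation_fun x = Infty <-> x = 0 ;
  valuationM : forall x y,
    valuation_fun (x * y) = add_value (valuation_fun x) (valuation_fun y) ;
  valuationD : forall x y,
    Num.min (valuation_fun x) (valuation_fun y) <= valuation_fun (x + y) ;
  valuation_nontrivial :
    exists x, x != 0 /\ valuation_fun x != Val 0
}.

Section ValuationTheory.
Variables (K : fieldType) (G : orderedAbGroupType) (v : valuation K G).

Lemma valuation0 : v 0 = Infty.
Proof. exact/valuation_Infty. Qed.

Lemma valuation1 : v 1 = Val 0.
Proof.
have := valuationM v 1 1; rewrite mulr1.
case E : (v 1) => [g|] /=.
  by move=> [] /(congr1 (fun x => x - g)); rewrite subrr addrK => <-.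
by move/valuation_Infty: E => /eqP; rewrite oner_eq0.
Qed.

Lemma valuationN1 : v (-1) = Val 0.
Proof.
have := valuationM v (-1) (-1); rewrite mulrNN mulr1 valuation1.
case: (v (-1)) => [g|] //= [] g0; congr Val; apply/eqP; rewrite eq_le.
have /orP[le0|le0] := orderedab_total 0 g.
  by have := orderedab_leD2l g _ _ le0; rewrite addr0 -g0 => ->; rewrite le0.
by have := orderedab_leD2l g _ _ le0; rewrite addr0 -g0 => ->; rewrite le0.
Qed.

Lemma valuationN x : v (- x) = v x.
Proof.
rewrite -mulN1r valuationM valuationN1.
by case: (v x) => [g|] //=; rewrite add0r.
Qed.

Lemma valuationB x y : Num.min (v x) (v y) <= v (x - y).
Proof. by rewrite -(valuationN y) valuationD. Qed.

End ValuationTheory.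

Section ResidueField.
Variables (K : fieldType) (G : orderedAbGroupType) (v : valuation K G).

Definition val_ring : {pred K} := [pred x | Val 0 <= v x].

Lemma val_ring_subring : subring_closed val_ring.
Proof.
split => [|x y|x y]; rewrite !inE.
- by rewrite valuation1.
- by move=> x0 y0; apply: le_trans (valuationB v x y); rewrite le_min x0.
- rewrite valuationM; case: (v x) (v y) => [g|] [h|] //=.
  rewrite !le_ValE => g0 h0; apply: (le_trans g0).
  by rewrite -[leLHS]addr0 orderedab_leD2l.
Qed.

HB.instance Definition _ :=
  GRing.isSubringClosed.Build K val_ring val_ring_subring.

Record val_ring_type := ValRing { of_val_ring : K; _ : of_val_ring \in val_ring }.

HB.instance Definition _ := [isSub for of_val_ring].
HB.instance Definition _ := [Choice of val_ring_type by <:].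
HB.instance Definition _ := [SubChoice_isSubComNzRing of val_ring_type by <:].

Definition max_ideal : {pred val_ring_type} :=
  [pred x : val_ring_type | Val 0 < v (val x)].

Lemma max_ideal_closed : idealr_closed max_ideal.
Proof.
split; rewrite ?inE.
- by rewrite rmorph0 valuation0 lt_Infty.
- by rewrite rmorph1 valuation1 ltxx.
move=> [a aA] x y; rewrite !inE => x0 y0.
rewrite rmorphD rmorphM /=.
apply: lt_le_trans (valuationD v _ _); rewrite lt_min y0 andbT valuationM.
move: aA x0; rewrite inE; case: (v a) => [g|] //; case: (v (val x)) => [h|] //=.
rewrite le_ValE !lt_ValE => g0 h0; apply: (lt_le_trans h0).
by rewrite -[leLHS]addr0 addrC [leLHS]addrC [leRHS]addrC orderedab_leD2l.
Qed.

HB.instance Definition _ :=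
  isIdealr.Build val_ring_type max_ideal max_ideal_closed.

Definition residue_field : comNzRingType := {ideal_quot max_ideal}.

End ResidueField.

(* An alias of K, so that the topology inferred on [vtop v] is the one of v. *)
Definition vtop (K : fieldType) (G : orderedAbGroupType)
  (v : valuation K G) : Type := K.

Section ValuationTopology.
Variables (K : fieldType) (G : orderedAbGroupType) (v : valuation K G).

HB.instance Definition _ := GRing.Field.on (vtop v).
HB.instance Definition _ := isPointed.Build (vtop v) (0 : K).

Definition vball (g : G) : set (vtop v * vtop v) :=
  [set xy | Val g < v (xy.2 - xy.1 : K)].

Definition vtop_entourage : set_system (vtop v * vtop v) :=
  filter_from [set: G] vball.

Lemma vtop_entourage_filter : Filter vtop_entourage.
Proof.
apply: filter_from_filter; first by exists 0.
move=> g h _ _; have /orP[gh|hg] := orderedab_total g h.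
  by exists h => // xy hxy; split=> //; exact: le_lt_trans hxy.
by exists g => // xy gxy; split=> //; exact: le_lt_trans gxy.
Qed.

Lemma vtop_entourage_diagonal A : vtop_entourage A -> (diagonal `<=` A)%classic.
Proof.
move=> [g _ gA] [x y] xy; apply: gA.
rewrite /vball /=; have -> : y = x by [].
by rewrite subrr valuation0 lt_Infty.
Qed.

Lemma vtop_entourage_inv A : vtop_entourage A -> vtop_entourage A^-1%relation.
Proof.
move=> [g _ gA]; exists g => // -[x y] xy; apply: gA.
by move: xy; rewrite /vball /= -valuationN opprB.
Qed.

Lemma vtop_entourage_split A : vtop_entourage A ->
  exists2 B, vtop_entourage B & (B \; B `<=` A)%relation.
Proof.
move=> [g _ gA]; exists (vball g); first by exists g.
move=> [x z] /= [y]; rewrite /vball /= => xy yz; apply: gA; rewrite /vball /=.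
rewrite -(subrKA y); apply: lt_le_trans (valuationD v _ _).
by rewrite lt_min xy yz.
Qed.

HB.instance Definition _ := isUniform.Build (vtop v)
  vtop_entourage_filter vtop_entourage_diagonal
  vtop_entourage_inv vtop_entourage_split.

Lemma nbhs0_vtop (U : set (vtop v)) :
  nbhs (0 : vtop v) U <-> exists g : G, [set x : vtop v | Val g < v x] `<=` U.
Proof.
rewrite -nbhs_entourageE; split.
  move=> [A [g _ gA] AU]; exists g => x gx; apply: AU; apply/xsectionP/gA.
  by rewrite /vball /= subr0.
move=> [g gU]; exists (vball g); first by exists g.
by move=> x /xsectionP; rewrite /vball /= subr0 => /gU.
Qed.

End ValuationTopology.

Definition countable_nbhs_basis (T : topologicalType) (x : T) :=
  exists B : set_system T,
    [/\ countable B, B `<=` nbhs x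
      & forall U, nbhs x U -> exists2 V, B V & V `<=` U].

Definition complete_uniform (T : puniformType) :=
  forall F : set_system T, ProperFilter F -> cauchy F -> cvg F.

Section PowerSeries.
Variables (L : fieldType) (G : orderedAbGroupType) (v : valuation L G).

Definition pseries (S : nat -> L) (x : L) : nat -> vtop v :=
  [series (S n * x ^+ n : vtop v)]_n.

Definition pseries_cvg (S : nat -> L) (x : L) : Prop := cvgn (pseries S x).

(* Meaningful only where the series converges; limits are then unique because
   the valuation topology is Hausdorff. *)
Definition pseries_sum (S : nat -> L) (x : L) : L := limn (pseries S x).

End PowerSeries.

(* Main.v *)
(** Let [{p, q} = {a, b}] with [v(S(q)) < alpha < v(S(p))].  On the ball
    [v(x) >= v(a)] the series [S] agrees with a polynomial [P] up to terms of
    valuation greater than [alpha].  Write [P(p + Y) = sum_k t_k Y^k], so that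
    [v(t_0) > alpha].  Since [G] is divisible, some [w] in [K] of maximal
    valuation satisfies [v(t_k w^k) = alpha] for some [k > 0] with [t_k <> 0];
    then [v(t_k w^k) >= alpha] for all [k], and [v(q - p) <= v(w)] because
    [v(P(q)) < alpha].  Dividing [P(p + w X)] by an element of valuation [alpha]
    gives an integral polynomial with nonzero reduction, which takes a unit value
    at some unit [u] of [K] because the residue field of [K] is infinite.  Avoiding
    also the residue class of [-p/w] ensures [v(p + u w) <= v(p)], and
    [c = p + u w] works. *)
Require Import Defs.
From HB Require Import structures.
From mathcomp Require Import all_boot all_order all_algebra.
From mathcomp Require Import all_classical topology sequences.
From mathcomp Require Import ring.

Set Implicit Arguments.
Unset Strict Implicit.
Unset Printing Implicit Defensive.

Import Order.TTheory GRing.Theory Num.Theory.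

Local Open Scope classical_set_scope.
Local Open Scope ring_scope.

(** * Ultrametric inequalities *)

Section Ultrametric.
Variables (K : fieldType) (G : orderedAbGroupType) (v : valuation K G).

Lemma valuation_finite x : x != 0 -> exists g, v x = Val g.
Proof.
move=> x0; case E: (v x) => [g|]; first by exists g.
by move/valuation_Infty: E x0 => ->; rewrite eqxx.
Qed.

Lemma valuation_mulr_le z x y : v x <= v y -> v (x * z) <= v (y * z).
Proof.
rewrite !valuationM; case: (v x) (v y) (v z) => [g|] [h|] [k|] //= gh.
by rewrite le_ValE ![_ + k]addrC orderedab_leD2l.
Qed.

Lemma valuation_expr_le n x y : v x <= v y -> v (x ^+ n) <= v (y ^+ n).
Proof.
move=> xy; elim: n => [|n IH]; first by rewrite !expr0.
rewrite !exprS; apply: le_trans (valuation_mulr_le _ xy) _.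
by rewrite ![y * _]mulrC valuation_mulr_le.
Qed.

Lemma valuationD_ge g x y : g <= v x -> g <= v y -> g <= v (x + y).
Proof. by move=> gx gy; apply: le_trans (valuationD v x y); rewrite le_min gx. Qed.

Lemma valuationD_gt g x y : g < v x -> g < v y -> g < v (x + y).
Proof.
by move=> gx gy; apply: lt_le_trans (valuationD v x y); rewrite lt_min gx.
Qed.

Lemma valuationB_gt g x y z : g < v (x - y) -> g < v (y - z) -> g < v (x - z).
Proof. by rewrite -[x - z](subrKA y); exact: valuationD_gt. Qed.

(** Otherwise [x = (x + y) - y] would have valuation greater than its own. *)
Lemma valuationDl x y : v x < v y -> v (x + y) = v x.
Proof.
move=> xy; apply/le_anti/andP; split; last by rewrite valuationD_ge // ltW.
rewrite leNgt; apply/negP => lt_x.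
have := @valuationD_gt (v x) (x + y) (- y) lt_x.
by rewrite valuationN => /(_ xy); rewrite addrK ltxx.
Qed.

Lemma valuationX n x g : v x = Val g -> v (x ^+ n) = Val (g *+ n).
Proof.
move=> xg; elim: n => [|n IH]; first by rewrite expr0 valuation1.
by rewrite exprS valuationM xg IH /= mulrS.
Qed.

Lemma valuationMV x z g : v z = Val g -> v x = add_value (v (x / z)) (Val g).
Proof.
move=> zg; rewrite -zg -valuationM divfK //; apply/eqP => z0.
by move: zg; rewrite z0 valuation0.
Qed.

Lemma valuation_div_ge0 x z g : v z = Val g -> (Val 0 <= v (x / z)) = (Val g <= v x).
Proof.
move=> zg; rewrite (valuationMV x zg); case: (v (x / z)) => [h|] //=.
rewrite !le_ValE; apply/idP/idP => [|gh].
  by move=> /(orderedab_leD2l g); rewrite addr0 addrC.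
by have := orderedab_leD2l (- g) _ _ gh; rewrite addNr addrC addrK.
Qed.

Lemma valuation_div_eq0 x z g : v z = Val g -> (v (x / z) = Val 0) <-> (v x = Val g).
Proof.
move=> zg; rewrite (valuationMV x zg); case: (v (x / z)) => [h|] //=.
split=> [[->]|[] /(congr1 (fun y => y - g))]; first by rewrite add0r.
by rewrite addrK subrr => ->.
Qed.

Lemma valuation_sum_ge (I : Type) (r : seq I) (P : pred I) (F : I -> K) g :
  (forall i, P i -> g <= v (F i)) -> g <= v (\sum_(i <- r | P i) F i).
Proof.
move=> gF; elim/big_ind: _ => //; last exact: valuationD_ge.
by rewrite valuation0; case: g {gF}.
Qed.

Lemma valuation_sum_gt (I : Type) (r : seq I) (P : pred I) (F : I -> K) g :
  (forall i, P i -> Val g < v (F i)) -> Val g < v (\sum_(i <- r | P i) F i).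
Proof.
move=> gF; elim/big_ind: _ => //; last exact: valuationD_gt.
by rewrite valuation0 lt_Infty.
Qed.

End Ultrametric.

(** * Residue classes and values of polynomials *)

Section ResidueAvoidance.
Variables (K L : fieldType) (G : orderedAbGroupType).
Variables (iota : {rmorphism K -> L}) (vK : valuation K G) (vL : valuation L G).
Hypothesis vL_extends : forall x : K, vL (iota x) = vK x.
Hypothesis K_residue_infinite : infinite_set [set: residue_field vK].

(** Finitely many classes cannot exhaust the residue field; any lift [u] of a class missed by [F]
    makes each [u - f] integral and outside the maximal ideal. *)
Lemma residue_avoidance (F : seq K) : {subset F <= val_ring vK} ->
  exists2 u, u \in val_ring vK & {in F, forall f, vK (u - f) = Val 0}.
Proof.
move=> FA; apply: contrapT => nex; apply: K_residue_infinite.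
pose s : seq (residue_field vK) :=
  [seq \pi_(residue_field vK)%qT (insubd 0 f : val_ring_type vK) | f <- F].
apply: (@sub_finite_set _ _ [set` s]); last exact: finite_seq.
move=> r _ /=; elim/quotW: r => -[u uA]; apply: contrapT => us; apply: nex.
exists u => // f fF; apply/le_anti; rewrite andbC.
have fA := FA _ fF.
apply/andP; split; first exact: (@rpredB _ (val_ring vK)).
rewrite leNgt; apply/negP => uf; apply: us; apply/mapP; exists f => //.
apply/eqP; rewrite -Quotient.idealrBE inE.
rewrite -(insubdK (0 : val_ring_type vK) fA) in uf.
exact: uf.
Qed.


(** Synthetic division by the monic ['X - u%:P] never leaves the valuation ring, so the quotient
    stays integral. *)
Lemma val_ring_factor_theorem (u : L) (C : {poly L}) :
  u \in val_ring vL -> C \is a polyOver (val_ring vL) ->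
  exists D : {poly L}, [/\ D \is a polyOver (val_ring vL),
    (size D <= (size C).-1)%N & C = D * ('X - u%:P) + C.[u]%:P].
Proof.
move=> uA; elim/poly_ind: C => [|C c IH] CA.
  by exists 0; rewrite rpred0 size_poly0 horner0 mul0r addr0.
have cA : c \in val_ring vL.
  by have := polyOverP CA 0%N; rewrite coefD coefMX coefC add0r.
have {}CA : C \is a polyOver (val_ring vL).
  apply/polyOverP => i.
  by have := polyOverP CA i.+1; rewrite coefD coefMX coefC addr0.
have [D [DA Dn CD]] := IH CA; exists (D * 'X + C.[u]%:P); split.
- by rewrite rpredD ?rpredM ?polyOverX ?polyOverC // rpred_horner.
- move: Dn; rewrite !size_MXaddC; case: (eqVneq C 0) => [->|C0] /=.
    by rewrite size_poly0 /= leqn0 size_poly_eq0 horner0 =>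
      /eqP ->; rewrite !eqxx.
  by rewrite -size_poly_gt0 in C0; case: ifP => // _ DC; rewrite -(prednK C0).
- rewrite [in LHS]CD !hornerE polyCD polyCM; ring.
Qed.

(** Induction on the size replaces counting roots of the reduction. If [C.[iota u]] is not a unit,
    [C] is congruent to [D * ('X - u)] modulo the maximal ideal, and the induction is applied to [D]
    with [u] added to [F], so that [w - u] is a unit as well. *)
Lemma integral_poly_unit_value (C : {poly L}) (F : seq K) : {subset F <= val_ring vK} ->
  C \is a polyOver (val_ring vL) -> (exists i, vL C`_i = Val 0) ->
  exists u, [/\ u \in val_ring vK, {in F, forall f, vK (u - f) = Val 0}
    & vL C.[iota u] = Val 0].
Proof.
have [n] := ubnP (size C); elim: n C F => // n IH C F Cn FA CA [i Ci].
have [u uA uF] := residue_avoidance FA.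
have iuA : iota u \in val_ring vL by rewrite inE vL_extends.
have CuA : C.[iota u] \in val_ring vL by rewrite rpred_horner.
have [Cu|Cu] := eqVneq (vL C.[iota u]) (Val 0); first by exists u.
have {Cu} Cu : Val 0 < vL C.[iota u] by rewrite lt_def Cu.
have [D [DA Dn CD]] := val_ring_factor_theorem iuA CA.
have Dn' : (size D < n)%N.
  case: n Cn {IH} => [|n] Cn.
    move: Cn Ci; rewrite ltnS leqn0 size_poly_eq0 => /eqP ->.
    by rewrite coef0 valuation0.
  by apply: leq_ltn_trans Dn _; case: (size C) Cn.
have uFA : {subset u :: F <= val_ring vK}.
  by move=> f; rewrite inE => /predU1P[->|/FA].
(* If all coefficients of [D] were in the maximal ideal, so would be those of [C], against [Ci]. *)
have Dunit : exists i, vL D`_i = Val 0.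
  apply: contrapT => nD.
  have Dgt j : Val 0 < vL D`_j.
    have := polyOverP DA j; rewrite inE lt_def => ->; rewrite andbT; apply/eqP => Dj.
    by apply: nD; exists j.
  suff : Val 0 < vL C`_i by rewrite Ci ltxx.
  rewrite CD coefD mulrBr coefB coefMX coefMC coefC.
  apply: valuationD_gt; last by case: ifP => // _; rewrite valuation0 lt_Infty.
  apply: valuationD_gt; first by case: ifP => // _; rewrite valuation0 lt_Infty.
  rewrite valuationN; apply: lt_le_trans (Dgt i) _.
  have := @valuation_mulr_le _ _ vL D`_i 1 (iota u).
  by rewrite mul1r [iota u * _]mulrC valuation1; exact.
have [w [wA wF Dw]] := IH D _ Dn' uFA DA Dunit.
exists w; split=> // [f fF|]; first by rewrite wF // inE fF orbT.
have wu : vL (D.[iota w] * (iota w - iota u)) = Val 0.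
  by rewrite valuationM Dw -rmorphB vL_extends wF ?mem_head //= addr0.
by rewrite CD !hornerE valuationDl wu.
Qed.

Hypothesis G_divisible : divisible G.

(** Divisibility supplies the valuation [(g - v(t)) / k] for [y]. *)
Lemma monomial_value (t : L) (k : nat) (g : G) : t != 0 -> (0 < k)%N ->
  exists y : K, vL (t * iota y ^+ k) = Val g.
Proof.
move=> t0 k0; have [h th] := valuation_finite vL t0.
have [l lk] := G_divisible (g - h) k0.
have [y yl] := valuation_surj vK (Val l).
exists y; rewrite -rmorphXn valuationM vL_extends (valuationX _ yl) th lk /=.
by rewrite addrC subrK.
Qed.

(** The polynomial case, recentred at [p]: here [t] stands for [P(p + Y)] and [d] for [q - p]. *)
Lemma shifted_poly_value (t : {poly L}) (d p : K) (g : G) :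
  vL t.[iota d] < Val g -> Val g < vL t.[0] ->
  exists y : K, [/\ vL t.[iota y] = Val g, vK d <= vK y & vK (p + y) <= vK p].
Proof.
rewrite horner_coef0 => td t0.
have term_le (z : L) x y k : vK x <= vK y ->
    vL (z * iota x ^+ k) <= vL (z * iota y ^+ k).
  rewrite ![z * _]mulrC => xy; apply: valuation_mulr_le.
  by apply: valuation_expr_le; rewrite !vL_extends.
(* The constant term exceeds [g], so a value below [g] at [d] must come from a term of positive
   degree. *)
have [k [k0 tk]] : exists k : 'I_(size t), (0 < k)%N /\
    vL (t`_k * iota d ^+ k) < Val g.
  apply: contrapT => nk; move: td; rewrite ltNge => /negP; apply.
  rewrite horner_coef; apply: valuation_sum_ge => -[[|k] kt] _ /=.
    by rewrite expr0 mulr1 ltW.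
  by rewrite leNgt; apply/negP => tk; apply: nk; exists (Ordinal kt).
pose good (i : 'I_(size t)) := (0 < i)%N && (t`_i != 0).
(* The value 0 at indices that are not [good] is a dummy; the maximum below ranges over [good]
   indices only. *)
have /choice[y yE] : forall i, exists y : K,
    good i -> vL (t`_i * iota y ^+ i) = Val g.
  move=> i; have [/andP[i0 ti]|] := boolP (good i); last by exists 0.
  by have [z zE] := monomial_value g ti i0; exists z.
have good_k : good k.
  rewrite /good k0; apply/eqP => tk0.
  by move: tk; rewrite tk0 mul0r valuation0.
have [m good_m m_max] := arg_maxP (fun i => vK (y i)) good_k.
pose w := y m.
have w0 : w != 0.
  apply/eqP => w0; have := yE m good_m; rewrite -/w w0 rmorph0.
  by case/andP: good_m => m0 _; rewrite expr0n eqn0Ngt m0 mulr0 valuation0.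
(* At [y k] the term of index [k] has valuation [g], but at [d] less than [g]; hence
   [v(d) <= v(y k) <= v(w)]. *)
have dw : vK d <= vK w.
  apply: le_trans (m_max k good_k); rewrite leNgt; apply/negP => /ltW yd.
  have := le_lt_trans (term_le t`_k _ _ k yd) tk.
  by rewrite yE // ltxx.
have [z zg] := valuation_surj vL (Val g).
pose C := \poly_(i < size t) (t`_i * iota w ^+ i / z).
have CA : C \is a polyOver (val_ring vL).
  apply/polyOverP => i; rewrite coef_poly.
  case: ltnP => [it|_]; last by rewrite rpred0.
  rewrite inE (valuation_div_ge0 _ zg).
  case: i it => [|i] it; first by rewrite expr0 mulr1 ltW.
  have [->|ti] := eqVneq t`_i.+1 0; first by rewrite mul0r valuation0.
  have good_i : good (Ordinal it) by rewrite /good ti.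
  by rewrite -(yE _ good_i); apply: term_le; exact: m_max good_i.
have Cm : vL C`_m = Val 0.
  by rewrite coef_poly ltn_ord; apply/(valuation_div_eq0 _ zg)/yE.
(* Avoiding 0 makes [u] a unit. The class of [- (p / w)] matters only if that quotient is integral;
   otherwise [v(p) < v(w)] and [p] dominates [p + u * w]. *)
pose F := 0 :: [seq e <- [:: - (p / w)] | e \in val_ring vK].
have FA : {subset F <= val_ring vK}.
  move=> e; rewrite inE => /predU1P[->|]; first by rewrite rpred0.
  by rewrite mem_filter => /andP[].
have [|u [uA uF Cu]] := integral_poly_unit_value FA CA; first by exists m.
have vu : vK u = Val 0 by rewrite -[u]subr0 uF ?mem_head.
have vuw : vK (u * w) = vK w.
  by rewrite valuationM vu; case: (vK w) => [h|] //=; rewrite add0r.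
exists (u * w); split; last 1 first.
- have [pw|wp] := leP (vK w) (vK p); last first.
    by rewrite valuationDl // vuw.
  have [h wh] := valuation_finite vK w0.
  have pwA : - (p / w) \in val_ring vK.
    by rewrite inE valuationN (valuation_div_ge0 _ wh) -wh.
  have upw : vK (u + p / w) = Val 0.
    by rewrite -[p / w]opprK uF // inE mem_filter pwA mem_head orbT.
  have -> : p + u * w = (u + p / w) * w by rewrite mulrDl divfK // addrC.
  rewrite valuationM upw; apply: le_trans pw.
  by rewrite wh /= add0r.
- apply/(valuation_div_eq0 _ zg); rewrite -Cu horner_poly horner_coef mulr_suml.
  congr (vL _); apply: eq_bigr => i _; rewrite rmorphM exprMn; ring.
- by rewrite vuw.
Qed.

End ResidueAvoidance.

(** * Convergence and tails of power series *)

Section SeriesTails.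
Variables (L : fieldType) (G : orderedAbGroupType) (v : valuation L G).
Implicit Types (S : nat -> L) (x : L).

Lemma pseries_horner S x n : pseries v S x n = (\poly_(i < n) S i).[x].
Proof. by rewrite horner_poly /pseries seriesEnat /= big_mkord. Qed.

Lemma pseries_subr_gt S x g N n :
  (forall m, (N <= m)%N -> Val g < v (S m * x ^+ m)) -> (N <= n)%N ->
  Val g < v (pseries v S x n - pseries v S x N : L).
Proof.
move=> SN Nn; rewrite /pseries sub_series_geq // big_nat_cond.
by apply: valuation_sum_gt => m /andP[/andP[/SN]].
Qed.

Lemma pseries_cvg_term S x g : pseries_cvg v S x ->
  exists N, forall n, (N <= n)%N -> Val g < v (S n * x ^+ n).
Proof.
move=> Sx.
have : entourage (@vball _ _ v g) by exists g.
move=> /(cvg_entourage Sx)[N _ NP].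
exists N => n Nn; have := NP n Nn; have := NP n.+1 (leqW Nn).
rewrite /vball /= => gSn1; rewrite -valuationN => gSn.
(* A term is the difference of two consecutive partial sums, both close to the limit. *)
have -> : S n * x ^+ n = (pseries v S x n.+1 - limn (pseries v S x)) +
    - (pseries v S x n - limn (pseries v S x)) :> L.
  by rewrite opprB addrA subrK; apply/esym/seriesSB.
exact: valuationD_gt.
Qed.

Lemma pseries_sum_tail S x g N : pseries_cvg v S x ->
  (forall n, (N <= n)%N -> Val g < v (S n * x ^+ n)) ->
  Val g < v (pseries_sum v S x - (\poly_(i < N) S i).[x]).
Proof.
move=> Sx SN; have : entourage (@vball _ _ v g) by exists g.
move=> /(cvg_entourage Sx)[M _ MP].
(* Past [M] the partial sums are close to the limit, past [N] to the truncation; the index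
   [maxn M N] serves both. *)
have := MP (maxn M N) (leq_maxl M N); rewrite /vball /= -valuationN opprB => gM.
have := pseries_subr_gt SN (leq_maxr M N) => gN.
by rewrite -pseries_horner; exact: valuationB_gt gM gN.
Qed.

(** By the ultrametric inequality, terms tending to 0 already make the partial sums Cauchy. *)
Lemma pseries_cvg_complete S x : complete_uniform (vtop v) ->
  (forall g, exists N, forall n, (N <= n)%N -> Val g < v (S n * x ^+ n)) ->
  pseries_cvg v S x.
Proof.
move=> cplt tl; apply: cplt => A [g _ gA].
have [N SN] := tl g.
pose U := [set n | (N <= n)%N].
exists ((pseries v S x) @` U, (pseries v S x) @` U).
  by split; exists N => // n Nn; exists n.
move=> [y z] [/= [m Nm <-] [n Nn <-]]; apply: gA; rewrite /vball /=.
have gm := pseries_subr_gt SN Nm; have gn := pseries_subr_gt SN Nn.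
by apply: valuationB_gt gn _; rewrite -valuationN opprB.
Qed.

Lemma pseries_cvg_le S x y : complete_uniform (vtop v) -> v x <= v y ->
  pseries_cvg v S x -> pseries_cvg v S y.
Proof.
move=> cplt xy Sx; apply: pseries_cvg_complete => // g.
have [N SN] := pseries_cvg_term g Sx; exists N => n /SN Sn.
apply: lt_le_trans Sn _; rewrite ![S n * _]mulrC.
exact/valuation_mulr_le/valuation_expr_le.
Qed.

End SeriesTails.

(** Treats both orders of [v(S(a))] and [v(S(b))] at once: [p] is the point where [S] has the larger
    valuation. *)
Lemma pseries_value_between (G : orderedAbGroupType) (K L : fieldType)
    (iota : {rmorphism K -> L}) (vK : valuation K G) (vL : valuation L G)
    (S : nat -> L) (a p q : K) (g : G) :
  (forall x : K, vL (iota x) = vK x) -> divisible G ->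
  infinite_set [set: residue_field vK] -> complete_uniform (vtop vL) ->
  pseries_cvg vL S (iota a) -> vK a <= vK p -> vK a <= vK q ->
  vL (pseries_sum vL S (iota q)) < Val g < vL (pseries_sum vL S (iota p)) ->
  exists c : K, [/\ pseries_cvg vL S (iota c),
    vL (pseries_sum vL S (iota c)) = Val g & vK a <= vK c <= vK p].
Proof.
move=> vLK Gdiv Kinf cplt Sa ap aq /andP[Sq Sp].
have Scvg x : vK a <= vK x -> pseries_cvg vL S (iota x).
  by move=> ax; apply: pseries_cvg_le Sa; rewrite // !vLK.
(* Terms at [x] have at least the valuation of those at [a] when [v(a) <= v(x)], so one truncation
   serves the whole ball. *)
have [N SN] := pseries_cvg_term g Sa.
pose P := \poly_(i < N) S i.
have PS x : vK a <= vK x ->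
    Val g < vL (pseries_sum vL S (iota x) - P.[iota x]).
  move=> ax; apply: pseries_sum_tail => [|n /SN Sn]; first exact: Scvg.
  apply: lt_le_trans Sn _; rewrite ![S n * _]mulrC.
  by apply: valuation_mulr_le; apply: valuation_expr_le; rewrite !vLK.
pose t := P \Po ('X + (iota p)%:P).
have tE x : t.[iota x] = P.[iota (p + x)].
  by rewrite horner_comp !hornerE rmorphD addrC.
have [||y [ty dy ypp]] :=
    @shifted_poly_value _ _ _ iota vK vL vLK Kinf Gdiv t (q - p) p g.
- rewrite tE addrC subrK -[P.[_]](subKr (pseries_sum vL S (iota q))).
  by rewrite valuationDl // valuationN (lt_trans Sq) // PS.
- rewrite -(rmorph0 iota) tE addr0.
  rewrite -[P.[_]](subKr (pseries_sum vL S (iota p))).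
  by rewrite valuationD_gt // valuationN PS.
(* Both [p] and [q - p] lie in the ball around 0 given by [v(a)], hence so do [y] and [p + y]. *)
have ac : vK a <= vK (p + y).
  apply: valuationD_ge => //; apply: le_trans dy.
  by apply: le_trans (valuationB vK q p); rewrite le_min aq.
exists (p + y); split; [exact: Scvg| |by rewrite ac].
rewrite -[pseries_sum _ _ _](subrK P.[iota (p + y)]) addrC.
by rewrite tE in ty; rewrite valuationDl ty // PS.
Qed.

Theorem theorem3p5 (G : orderedAbGroupType) (K L : fieldType)
  (iota : {rmorphism K -> L}) (vK : valuation K G) (vL : valuation L G)
  (vL_extends : forall x : K, vL (iota x) = vK x)
  (G_divisible : divisible G)
  (K_residue_infinite : infinite_set [set: residue_field vK])
  (L_countable_basis : countable_nbhs_basis (0 : vtop vL))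
  (L_complete : complete_uniform (vtop vL))
  (S : nat -> L) (a b : K) (le_ab : vK a <= vK b)
  (S_cvg_a : pseries_cvg vL S (iota a))
  (Sab : pseries_sum vL S (iota a) <> pseries_sum vL S (iota b))
  (alpha : value G)
  (alpha_between :
     Num.min (vL (pseries_sum vL S (iota a))) (vL (pseries_sum vL S (iota b)))
       <= alpha
       <= Num.max (vL (pseries_sum vL S (iota a)))
                  (vL (pseries_sum vL S (iota b)))) :
  exists c : K,
    [/\ pseries_cvg vL S (iota c),
        vL (pseries_sum vL S (iota c)) = alpha
      & vK a <= vK c <= vK b].
Proof.
have Sb : pseries_cvg vL S (iota b).
  by apply: pseries_cvg_le S_cvg_a; rewrite // !vL_extends.
have [->|alpha_a] := eqVneq alpha (vL (pseries_sum vL S (iota a))).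
  by exists a; rewrite lexx.
have [->|alpha_b] := eqVneq alpha (vL (pseries_sum vL S (iota b))).
  by exists b; rewrite le_ab lexx.
move: alpha_between alpha_a alpha_b.
case: (ltgtP (vL (pseries_sum vL S (iota a)))
             (vL (pseries_sum vL S (iota b)))) => [_|_|<-];
  last by move=> /le_anti ->; rewrite eqxx.
- move=> /andP[alo ahi] alpha_a alpha_b.
  have {}alo : vL (pseries_sum vL S (iota a)) < alpha by rewrite lt_def alpha_a.
  have {}ahi : alpha < vL (pseries_sum vL S (iota b)).
    by rewrite lt_neqAle alpha_b.
  (* Lying strictly below another value, [alpha] cannot be [Infty]. *)
  case: alpha alo ahi {alpha_a alpha_b} => [g|] alo ahi; last first.
    by move: ahi; rewrite ltNge; case: (vL _).
  by apply: (pseries_value_between vL_extends G_divisible K_residue_infinite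
    L_complete S_cvg_a le_ab (lexx _)); rewrite alo.
- move=> /andP[blo ahi] alpha_a alpha_b.
  have {}blo : vL (pseries_sum vL S (iota b)) < alpha by rewrite lt_def alpha_b.
  have {}ahi : alpha < vL (pseries_sum vL S (iota a)).
    by rewrite lt_neqAle alpha_a.
  case: alpha blo ahi {alpha_a alpha_b} => [g|] blo ahi; last first.
    by move: ahi; rewrite ltNge; case: (vL _).
  (* With [p = a] the bound obtained is [v(c) <= v(a)], which [le_ab] extends to [v(b)]. *)
  have [|c [Sc Scg /andP[ac ca]]] := pseries_value_between vL_extends G_divisible
    K_residue_infinite L_complete S_cvg_a (lexx _) le_ab (g := g).
    by rewrite blo.
  by exists c; split=> //; rewrite ac (le_trans ca).
Qed.
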